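(* Let $\tau$ be a type and let $G$ be a $\tau$-homogeneous countable torsion-free abelian group. Then $G$ has a Main Decomposition.
   Context: A type is an isomorphism class of torsion-free abelian groups of rank $1$; the type of a non-zero element $x$ of a torsion-free abelian group $G$ is the type of the pure rank-one subgroup $\langle x\rangle_*$ of $G$ generated by $x$. $G$ is $\tau$-homogeneous if every non-zero element of $G$ has type $\tau$. A torsion-free abelian group is completely decomposable if it is a direct sum (possibly infinite, possibly empty) of groups of rank $1$; it is clipped if it has no direct summand of rank $1$. A Main Decomposition of $G$ is a decomposition $G = A \oplus H$ in which $A$ is completely decomposable and $H$ is clipped. *)

(* Defs.v *)
From HB Require Import structures.
From mathcomp Require Import all_boot all_order all_algebra.
From mathcomp Require Import all_classical.

Set Implicit Arguments.
Unset Strict Implicit.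
Unset Printing Implicit Defensive.

Import GRing.Theory.

Local Open Scope classical_set_scope.
Local Open Scope ring_scope.

Definition torsion_free (G : zmodType) : Prop :=
  forall (n : nat) (x : G), (0 < n)%N -> x *+ n = 0 -> x = 0.

Definition subgroup (G : zmodType) (A : set G) : Prop := zmod_closed [in A].

Definition generated (G : zmodType) (S : set G) : set G :=
  smallest (@subgroup G) S.

Definition Zindependent (G : zmodType) (n : nat) (x : 'I_n -> G) : Prop :=
  forall c : 'I_n -> int, \sum_i x i *~ c i = 0 -> forall i, c i = 0.

Definition has_rank (G : zmodType) (n : nat) (A : set G) : Prop :=
  (exists2 x : 'I_n -> G, forall i, A (x i) & Zindependent x) /\
  (forall x : 'I_n.+1 -> G, (forall i, A (x i)) -> ~ Zindependent x).

Definition pure_subgroup (G : zmodType) (A : set G) : Prop :=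
  subgroup A /\
  forall (n : nat) (y : G), A (y *+ n) -> exists2 a, A a & a *+ n = y *+ n.

(* In a torsion-free group an intersection of pure subgroups is pure, so that
   [pure_hull x] is the least pure subgroup containing [x]. *)
Definition pure_hull (G : zmodType) (x : G) : set G :=
  smallest (@pure_subgroup G) [set x].

(* A collection of groups is a predicate on [zmodType]; [iso_class A] is the
   collection of all groups isomorphic to the subgroup [A] of [G]. *)
Definition iso_class (G : zmodType) (A : set G) (U : zmodType) : Prop :=
  exists2 f : {additive U -> G}, injective f & range f = A.

Definition is_type (tau : zmodType -> Prop) : Prop :=
  exists T : zmodType,
    [/\ torsion_free T, has_rank 1 [set: T] & tau = iso_class [set: T]].

Definition type_of (G : zmodType) (x : G) : zmodType -> Prop :=
  iso_class (pure_hull x).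

Definition homogeneous (tau : zmodType -> Prop) (G : zmodType) : Prop :=
  forall x : G, x <> 0 -> type_of x = tau.

Definition direct_sum2 (G : zmodType) (A B C : set G) : Prop :=
  [/\ subgroup B, subgroup C, A = [set b + c | b in B & c in C]
    & B `&` C = [set 0]].

Definition direct_sum (G : zmodType) (A : set G) (I : Type) (B : I -> set G) :
    Prop :=
  [/\ forall i, subgroup (B i), A = generated (\bigcup_i B i)
    & forall i, B i `&` generated (\bigcup_(j in [set j | j <> i]) B j)
                = [set 0]].

Definition completely_decomposable (G : zmodType) (A : set G) : Prop :=
  exists (I : Type) (B : I -> set G),
    direct_sum A B /\ forall i, has_rank 1 (B i).

Definition clipped (G : zmodType) (A : set G) : Prop :=
  ~ exists B C : set G, direct_sum2 A B C /\ has_rank 1 B.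

Definition main_decomposition (G : zmodType) (A H : set G) : Prop :=
  [/\ direct_sum2 [set: G] A H, completely_decomposable A & clipped H].

(* Main.v *)
(* Let T be a group of type tau and H the intersection of the kernels of all
   homomorphisms G -> T.  Starting from K = H, enlarge K by summands isomorphic
   to T until every element of the countable group G is absorbed.  Given x
   outside K, some f : G -> T vanishes on K but not at x; the pure subgroup K'
   generated by K and x then satisfies K' `&` ker f = K, and since K' is
   tau-homogeneous and End T is a principal ideal domain, f restricted to K' is
   an integer multiple of a split epimorphism onto T, so K' = K + s(T) directly.
   In the union, G is the direct sum of H and of copies of T.  Finally H is
   clipped: a rank-one summand of H would be a summand of G isomorphic to T, on
   which the projection is a homomorphism to T that does not vanish on H. *)
From HB Require Import structures.
Require Import Defs.
From mathcomp Require Import all_boot all_order all_algebra.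
From mathcomp Require Import all_classical.

Set Implicit Arguments.
Unset Strict Implicit.
Unset Printing Implicit Defensive.

Import Order.TTheory GRing.Theory Num.Theory.

Local Open Scope classical_set_scope.
Local Open Scope ring_scope.

(** * Subgroups, torsion-freeness and purity *)

Lemma subgroupP (G : zmodType) (A : set G) :
  subgroup A <-> A 0 /\ forall x y, A x -> A y -> A (x - y).
Proof.
split=> [[A0 AB]|[A0 AB]].
  split=> [|x y Ax Ay]; first by rewrite -in_setE.
  by rewrite -in_setE; apply: AB; rewrite in_setE.
split=> [|x y]; first by rewrite in_setE.
by rewrite !in_setE; apply: AB.
Qed.

Lemma subgroup0 (G : zmodType) (A : set G) : subgroup A -> A 0.
Proof. by case/subgroupP. Qed.

Lemma subgroupB (G : zmodType) (A : set G) x y :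
  subgroup A -> A x -> A y -> A (x - y).
Proof. by case/subgroupP => _; apply. Qed.

Lemma subgroupN (G : zmodType) (A : set G) x : subgroup A -> A x -> A (- x).
Proof.
by move=> sA Ax; rewrite -sub0r; apply: subgroupB => //; apply: subgroup0.
Qed.

Lemma subgroupD (G : zmodType) (A : set G) x y :
  subgroup A -> A x -> A y -> A (x + y).
Proof.
move=> sA Ax Ay; rewrite -[y]opprK.
by apply: subgroupB => //; apply: subgroupN.
Qed.

Lemma subgroupMz (G : zmodType) (A : set G) x (m : int) :
  subgroup A -> A x -> A (x *~ m).
Proof.
move=> sA Ax; have AMn n : A (x *+ n).
  elim: n => [|n IHn]; first by rewrite mulr0n; apply: subgroup0.
  by rewrite mulrS; apply: subgroupD.
case: m => n; first by rewrite -pmulrn.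
by rewrite NegzE mulrNz -pmulrn; apply: subgroupN.
Qed.

Lemma subgroup_generated (G : zmodType) (S : set G) : subgroup (generated S).
Proof.
apply/subgroupP; split=> [P [sP _]|x y gx gy P sP]; first exact: subgroup0.
by apply: subgroupB; [case: sP | exact: gx | exact: gy].
Qed.

Lemma generated_mono (G : zmodType) (S S' : set G) :
  S `<=` S' -> generated S `<=` generated S'.
Proof.
by move=> SS'; apply: sub_smallest2r => //; apply: subgroup_generated.
Qed.

Lemma torsion_freeMz (G : zmodType) (x : G) (m : int) :
  torsion_free G -> m <> 0 -> x *~ m = 0 -> x = 0.
Proof.
move=> tfG m0 xm0; apply: (tfG `|m|%N); first by rewrite absz_gt0; apply/eqP.
rewrite pmulrn; case: (intP m) m0 xm0 => // n _.
by rewrite abszN mulrNz => /eqP; rewrite oppr_eq0 => /eqP.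
Qed.

Lemma torsion_free_injMz (G : zmodType) (x y : G) (m : int) :
  torsion_free G -> m <> 0 -> x *~ m = y *~ m -> x = y.
Proof.
move=> tfG m0 e; apply/eqP; rewrite -subr_eq0; apply/eqP.
by apply: (torsion_freeMz tfG m0); rewrite mulrzBl e subrr.
Qed.

Lemma torsion_free_pureP (G : zmodType) (A : set G) : torsion_free G ->
  pure_subgroup A <->
  subgroup A /\ forall (m : int) y, m <> 0 -> A (y *~ m) -> A y.
Proof.
move=> tfG; split=> -[sA pA]; split=> //.
  move=> m y m0 Ay.
  have : A (y *+ `|m|%N).
    rewrite pmulrn abszE; case: (ger0P m) => // _.
    by rewrite mulrNz; apply: subgroupN.
  case/pA => a Aa /eqP; rewrite -subr_eq0 -mulrnBl => /eqP e.
  have /eqP : a - y = 0 by apply: tfG e; rewrite absz_gt0; apply/eqP.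
  by rewrite subr_eq0 => /eqP <-.
move=> [|n] y Ay; first by exists 0; [exact: subgroup0 | rewrite !mulr0n].
by exists y => //; apply: (pA n.+1).
Qed.

Lemma pure_hull_pure (G : zmodType) (x : G) :
  torsion_free G -> pure_subgroup (pure_hull x).
Proof.
move=> tfG; apply/torsion_free_pureP => //; split.
  apply/subgroupP; split=> [P [[sP _] _]|y z hy hz P cP].
    exact: subgroup0.
  by apply: subgroupB; [case: cP => -[] | exact: hy | exact: hz].
move=> m y m0 hy P [/[dup] pP /(torsion_free_pureP _ tfG) [_ h] xP].
by apply: (h m) => //; apply: hy.
Qed.

(** * Homomorphisms and groups of rank one *)

Lemma additive_of (U V : zmodType) (f : U -> V) :
  zmod_morphism f -> exists g : {additive U -> V}, g =1 f.
Proof.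
move=> fB; pose A := GRing.isZmodMorphism.Build U V f fB.
pose g : {additive U -> V} := HB.pack f A.
by exists g.
Qed.

Lemma additive_mulrz (U V : zmodType) (f : {additive U -> V}) (m : int) :
  exists g : {additive U -> V}, forall x, g x = f x *~ m.
Proof.
by apply: additive_of => x y; rewrite raddfB mulrzBl.
Qed.

Lemma rank1_neq0 (G : zmodType) (A : set G) :
  has_rank 1 A -> exists2 x, A x & x <> 0.
Proof.
move=> [[x Ax ix] _]; exists (x ord0) => // x0.
have /(_ _ ord0)/eqP := ix (fun=> 1); rewrite oner_eq0 => h.
by suff: false by []; apply: h; rewrite big_ord1 x0 mul0rz.
Qed.

Lemma rank1_dependent (G : zmodType) (A : set G) x y :
  torsion_free G -> has_rank 1 A -> A x -> A y -> y <> 0 ->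
  exists a b : int, a <> 0 /\ x *~ a = y *~ b.
Proof.
move=> tfG [_ dep] Ax Ay y0.
pose z (i : 'I_2) := if i == 0 then x else y.
have : ~ Zindependent z by apply: dep => i; rewrite /z; case: ifP.
move=> /existsNP[c /not_implyP[]].
rewrite big_ord_recl big_ord1 /z /= => e /existsNP[i ci].
exists (c ord0), (- c (lift ord0 ord0)); split; last first.
  by rewrite mulrNz; apply/eqP; rewrite -addr_eq0; apply/eqP.
move=> c0; apply: ci; move: e; rewrite c0 mulr0z add0r => e.
have c1 : c (lift ord0 ord0) = 0.
  by apply: contrapT => c1; apply: y0; apply: torsion_freeMz e.
by case: (unliftP ord0 i) => [j|] -> //; rewrite ord1.
Qed.

(* [End T] is a subring of the rationals, and [T] is divisible by the
   denominator [a] of an endomorphism [c / a] in lowest terms: the Bezout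
   relation gives [t = (u t + v e(t)) a]. *)
Lemma rank1_endomorphism (T : zmodType) (e : {additive T -> T}) :
  torsion_free T -> has_rank 1 [set: T] ->
  exists a c u v : int,
    [/\ a <> 0, u * a + v * c = 1 & forall t, e t *~ a = t *~ c].
Proof.
move=> tfT rT; have [t0 _ t00] := rank1_neq0 rT.
have [a [c [a0 eac]]] := rank1_dependent (x := e t0) (y := t0) tfT rT I I t00.
(* The relation at [t0] passes to every [t], because some non-zero multiple of [t] is a multiple of
   [t0]. *)
have {}eac t : e t *~ a = t *~ c.
  have [w [z [w0 wz]]] := rank1_dependent (x := t) (y := t0) tfT rT I I t00.
  apply: (torsion_free_injMz tfT w0).
  by rewrite mulrzAC -raddfMz wz raddfMz mulrzAC eac mulrzAC -wz mulrzAC.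
have g0 : gcdz a c <> 0 by move/eqP; rewrite gcdz_eq0 => /andP[/eqP].
have [u [v uv]] := Bezoutz a c.
exists (a %/ gcdz a c)%Z, (c %/ gcdz a c)%Z, u, v; split.
- by move=> a0'; apply: a0; rewrite -(divzK (dvdz_gcdl a c)) a0' mul0r.
- apply: (mulIf (x := gcdz a c)); first exact/eqP.
  by rewrite mulrDl -!mulrA !divzK ?dvdz_gcdl ?dvdz_gcdr// uv mul1r.
- move=> t; apply: (torsion_free_injMz tfT g0).
  by rewrite -!mulrzA !divzK ?dvdz_gcdl ?dvdz_gcdr.
Qed.

(* [b] generates the ideal of [End T] formed by the [f \o s] with [s] a
   homomorphism from [T] to [L]; thus [f / b] splits. *)
Lemma homogeneous_quasi_split (G T : zmodType) (L : set G)
    (f : {additive G -> T}) :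
  torsion_free T -> has_rank 1 [set: T] -> subgroup L ->
  (forall y, L y -> y <> 0 -> exists (psi : {additive T -> G}) (t : T),
     (forall u, L (psi u)) /\ psi t = y) ->
  (exists2 x, L x & f x <> 0) ->
  exists (s : {additive T -> G}) (b : int),
    [/\ b <> 0, forall t, L (s t), forall t, f (s t) = t *~ b
      & forall y, L y -> exists t, f y = t *~ b].
Proof.
move=> tfT rT sL hL [y0 Ly0 fy0].
(* These are the positive integers among the endomorphisms [f \o s]; the least of them will be
   [b]. *)
pose P (b : nat) := `[< (0 < b)%N /\ exists s : {additive T -> G},
  (forall t, L (s t)) /\ forall t, f (s t) = t *~ b%:Z >].
have Pabs (m : int) (s : {additive T -> G}) : m <> 0 -> (forall t, L (s t)) ->
    (forall t, f (s t) = t *~ m) -> P `|m|%N.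
  move=> m0 Ls fs; apply/asboolP; split; first by rewrite absz_gt0; apply/eqP.
  have [s' s'E] := additive_mulrz s (sgz m).
  exists s'; split=> t; rewrite s'E; first exact: subgroupMz.
  by rewrite raddfMz fs -mulrzA abszE (mulrC m) normrEsg sgrEz intz.
have neq0 y : f y <> 0 -> y <> 0 by move=> h y_0; apply: h; rewrite y_0 raddf0.
(* If [f \o psi] is [c / a], then [a psi] realises the integer [c], which is non-zero because [f y0]
   is. *)
have exP : exists b, P b.
  have [psi [t [Lpsi psit]]] := hL _ Ly0 (neq0 _ fy0).
  have [a [c [u [v [a0 _ eac]]]]] := rank1_endomorphism (f \o psi) tfT rT.
  have [s sE] := additive_mulrz psi a.
  exists `|c|%N; apply: (Pabs _ s) => [c0|t'|t'].
  - by apply: fy0; rewrite -psit; apply: (torsion_freeMz tfT a0);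
      rewrite eac c0 mulr0z.
  - by rewrite sE; apply: subgroupMz.
  - by rewrite sE raddfMz eac.
have [b /asboolP[b0 [s [Ls fs]]] bmin] := ex_minnP exP.
have bn0 : b%:Z <> 0 by case: (b) b0.
exists s, b; split=> // y Ly.
have [fy|fy] := pselect (f y = 0); first by exists 0; rewrite fy mul0rz.
have [psi [t [Lpsi psit]]] := hL _ Ly (neq0 _ fy).
have [a [c [u [v [a0 uv eac]]]]] := rank1_endomorphism (f \o psi) tfT rT.
have {}eac w : f (psi w) *~ a = w *~ c by exact: eac.
have [x [z xz]] := Bezoutz b c.
have [s1 s1E] := additive_mulrz s x.
have [s2 s2E] := additive_mulrz psi (a * z).
(* The combination [x s + z a psi] realises the gcd of [b] and [c], so minimality of [b] forces [b]
   to divide [c]. *)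
have : P `|gcdz b c|%N.
  apply: (Pabs _ (s1 \+ s2)) => [/eqP|t'|t'].
  - by rewrite gcdz_eq0 => /andP[/eqP].
  - by rewrite /= s1E s2E; apply: subgroupD => //; apply: subgroupMz.
  - rewrite /= s1E s2E raddfD !raddfMz fs mulrzA eac -!mulrzA -mulrzDr.
    by rewrite -xz mulrC [c * z]mulrC.
move=> /bmin b_le.
have bc : (b %| c)%Z.
  rewrite dvdzE absz_nat; move: b_le; rewrite /gcdz !absz_nat => b_le.
  have /eqP <- : gcdn b `|c| == b.
    by rewrite eqn_leq b_le andbT; apply: dvdn_leq => //; apply: dvdn_gcdl.
  exact: dvdn_gcdr.
(* This is [t / a], supplied by the Bezout relation; then [f y = t' c], and [b] divides [c]. *)
pose t' := t *~ u + f (psi t) *~ v.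
have t'a : t' *~ a = t.
  rewrite /t' mulrzDl [f _ *~ _ *~ _]mulrzAC eac -!mulrzA.
  by rewrite -mulrzDr [c * v]mulrC uv.
exists (t' *~ (c %/ b)%Z); rewrite -mulrzA divzK// -eac -psit -[in LHS]t'a.
by rewrite !raddfMz.
Qed.

(** * The radical and the extension of quasi-summands *)

Definition hom_radical (G T : zmodType) : set G :=
  [set x | forall f : {additive G -> T}, f x = 0].

Lemma hom_radical_pure (G T : zmodType) :
  torsion_free G -> torsion_free T -> pure_subgroup (@hom_radical G T).
Proof.
move=> tfG tfT; apply/torsion_free_pureP => //; split.
  apply/subgroupP; split=> [f|x y hx hy f]; first by rewrite raddf0.
  by rewrite raddfB hx hy subrr.
by move=> m y m0 hy f; apply: (torsion_freeMz tfT m0); rewrite -raddfMz.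
Qed.

(* Up to the factor [N] and modulo the radical, [q] is a projection of [G]
   onto [K]; through it, homomorphisms that kill [K] are obtained. *)
Definition quasi_summand (G T : zmodType) (K : set G) : Prop :=
  [/\ pure_subgroup K, hom_radical T `<=` K
    & exists (q : {additive G -> G}) (N : int),
      [/\ N <> 0, forall g, K (q g)
        & forall k, K k -> hom_radical T (q k - k *~ N)]].

(** Homogeneity of [G], with one fixed group [T] representing the type. *)
Definition pure_hulls_iso (G T : zmodType) : Prop :=
  forall x : G, x <> 0 ->
    exists phi : {additive T -> G}, injective phi /\ range phi = pure_hull x.

Lemma quasi_summand_extend (G T : zmodType) (K : set G) (x : G) :
  torsion_free G -> torsion_free T -> has_rank 1 [set: T] ->
  pure_hulls_iso G T -> quasi_summand T K ->
  exists K' B : set G,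
    [/\ quasi_summand T K', direct_sum2 K' K B, K' x
      & B = [set 0] \/
        exists s : {additive T -> G}, injective s /\ range s = B].
Proof.
move=> tfG tfT rT hG qK.
have [[sK pK] RK [q [N [N0 Kq qN]]]] := qK.
have /(torsion_free_pureP _ tfG)[_ {}pK] : pure_subgroup K by [].
have [Kx|Kx] := pselect (K x).
  exists K, [set 0]; split=> //; last by left.
  split=> //.
  - apply/subgroupP; split=> // y z -> ->; exact: subr0.
  - apply/seteqP; split=> [y Ky|_ [y Ky [_ -> <-]]]; last by rewrite addr0.
    by exists y => //; exists 0 => //; rewrite addr0.
  - apply/seteqP; split=> [y [_ ->] //|y ->]; split=> //; exact: subgroup0.
(* Otherwise [N x] is the sum of [q x] and an element of the radical, hence lies in [K], and purity
   gives [K x]. *)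
have Rx : ~ hom_radical T (x *~ N - q x).
  move=> Rx; apply: Kx; apply: (pK N) => //.
  by rewrite -(subrK (q x) (x *~ N)); apply: subgroupD => //; apply: RK.
have {Rx} [h hx] : exists h : {additive G -> T}, h (x *~ N - q x) <> 0.
  by apply/existsNP.
(* [N - q] maps [K] into the radical, which [h] kills; so [f] vanishes on [K] but not at [x]. *)
have [f fE] : exists f : {additive G -> T}, forall g, f g = h (g *~ N - q g).
  apply: additive_of => y z.
  rewrite -raddfB; congr (h _).
  by rewrite mulrzBl raddfB !opprD !opprK addrACA.
have fK k : K k -> f k = 0.
  by move=> Kk; rewrite fE -opprB raddfN (qN k Kk) oppr0.
have fx : f x <> 0 by rewrite fE.
(* The purification of the subgroup generated by [K] and [x]. *)
pose K' : set G :=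
  [set y | exists m n : int, m <> 0 /\ K (y *~ m - x *~ n)].
have KK' : K `<=` K'.
  by move=> y Ky; exists 1, 0; split=> //; rewrite mulr0z subr0 mulr1z.
have K'x : K' x.
  by exists 1, 1; split=> //; rewrite subrr; apply: subgroup0.
have sK' : subgroup K'.
  apply/subgroupP; split; first by apply/KK'; apply: subgroup0.
  move=> y z [m [n [m0 Ky]]] [m' [n' [m0' Kz]]].
  exists (m * m'), (n * m' - n' * m); split.
    by move/eqP; rewrite mulf_eq0 => /orP[/eqP|/eqP].
  have -> : (y - z) *~ (m * m') - x *~ (n * m' - n' * m) =
      (y *~ m - x *~ n) *~ m' - (z *~ m' - x *~ n') *~ m.
    rewrite !mulrzBl mulrzBr -!mulrzA [m' * m]mulrC !opprD !opprK.
    by rewrite addrACA.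
  by apply: subgroupB => //; apply: subgroupMz.
have pK' : pure_subgroup K'.
  apply/torsion_free_pureP => //; split=> // m y m0 [m' [n' [m0' Ky]]].
  exists (m * m'), n'; split; last by rewrite mulrzA.
  by move/eqP; rewrite mulf_eq0 => /orP[/eqP|/eqP].
(* Applying [f] to [m y - n x] leaves [n (f x) = 0], so [n = 0] and purity of [K] applies. *)
have kerK' y : K' y -> f y = 0 -> K y.
  move=> [m [n [m0 Ky]]] fy; apply: (pK m) => //.
  have n0 : n = 0.
    apply: contrapT => n0; apply: fx; apply: (torsion_freeMz tfT n0).
    have := fK _ Ky; rewrite raddfB !(raddfMz f) fy mul0rz sub0r => /eqP.
    by rewrite oppr_eq0 => /eqP.
  by move: Ky; rewrite n0 mulr0z subr0.
(* Since [K'] is pure, it contains the pure hull of each of its elements; the isomorphism of [T]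
   with that hull is the required [psi]. *)
have [||s [b [b0 K's fs fb]]] := homogeneous_quasi_split (f := f) tfT rT sK'.
- move=> y K'y y0; have [phi [_ rphi]] := hG y y0.
  have hullK' : pure_hull y `<=` K' by apply: smallest_sub => // _ ->.
  have [t _ phit] : range phi y by rewrite rphi; move=> P [_ yP]; apply: yP.
  by exists phi, t; split=> // u; apply: hullK'; rewrite -rphi; exists u.
- by exists x.
(* From [f y = b t = f (s t)] it follows that [y - s t] is in the kernel of [f] on [K'], which is
   [K]. *)
have decomp y : K' y -> exists k t, K k /\ y = k + s t.
  move=> K'y; have [t ft] := fb y K'y.
  exists (y - s t), t; split; last by rewrite subrK.
  apply: kerK'; first exact: subgroupB.
  by rewrite raddfB fs ft subrr.
have s_eq0 t : f (s t) = 0 -> t = 0 by rewrite fs; apply: torsion_freeMz.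
have sS : subgroup (range s).
  apply/subgroupP; split; first by exists 0 => //; rewrite raddf0.
  by move=> _ _ [t _ <-] [u _ <-]; exists (t - u) => //; rewrite raddfB.
exists K', (range s); split=> //; last first.
- right; exists s; split=> // t u stu; apply/eqP; rewrite -subr_eq0; apply/eqP.
  by apply: s_eq0; rewrite raddfB stu subrr raddf0.
- split=> //.
  + apply/seteqP; split=> [y /decomp[k [t [Kk ->]]]|_ [k Kk [_ [t _ <-] <-]]].
      by exists k => //; exists (s t) => //; exists t.
    by apply: subgroupD => //; apply: KK'.
  + apply/seteqP; split=> [y [Ky [t _ sty]]|y ->].
      by rewrite -sty (s_eq0 t) ?raddf0// sty fK.
    by split; [exact: subgroup0 | exists 0 => //; rewrite raddf0].
split=> //; first by move=> y /RK /KK'.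
(* Modulo the radical, [q'] is multiplication by [b N] on [K], where [f] is
   zero, and on [range s], where [f (s t) = b t]. *)
have [q' q'E] : exists q' : {additive G -> G}, forall g,
    q' g = q g *~ b + s (f g) *~ N - q (s (f g)).
  apply: additive_of => y z.
  rewrite (raddfB f) !(raddfB s) !(raddfB q) !mulrzBl !opprD !opprK.
  by rewrite [_ - _ + (_ - _)]addrACA [LHS]addrACA.
exists q', (b * N); split.
- by move/eqP; rewrite mulf_eq0 => /orP[/eqP|/eqP].
- move=> g; rewrite q'E; apply: subgroupB => //; last exact: KK'.
  by apply: subgroupD => //; apply: subgroupMz => //; apply: KK'.
move=> y /decomp[k [t [Kk ->]]].
have -> : q' (k + s t) - (k + s t) *~ (b * N) = (q k - k *~ N) *~ b.
  rewrite q'E (raddfD f) fK// add0r fs !(raddfMz s) !(raddfD q) !(raddfMz q).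
  rewrite !mulrzDl mulNrz !mulrzA.
  rewrite [k *~ b *~ N]mulrzAC [_ + _ + s t *~ b *~ N]addrAC addrK opprD.
  by rewrite addrACA subrr addr0.
have [sR _] := hom_radical_pure tfG tfT.
exact: (subgroupMz b sR (qN _ Kk)).
Qed.

(** * Rank-one images and clippedness of the radical *)

Lemma has_rank1_range (T G : zmodType) (s : {additive T -> G}) :
  injective s -> has_rank 1 [set: T] -> has_rank 1 (range s).
Proof.
move=> injs [[x _ ix] dep]; split.
  exists (s \o x) => [i|c /= e]; first by exists (x i).
  apply: ix; apply: injs; rewrite raddf0 raddf_sum -[RHS]e.
  by apply: eq_bigr => i _; rewrite raddfMz.
move=> y ys iy.
have /choice[z zy] i : exists t, s t = y i by have [t _] := ys i; exists t.
apply: (dep z) => // c e; apply: iy.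
transitivity (s (\sum_i z i *~ c i)); last by rewrite e raddf0.
by rewrite raddf_sum; apply: eq_bigr => i _; rewrite raddfMz zy.
Qed.

Lemma hom_radical_clipped (G T : zmodType) (A : set G) :
  torsion_free G -> torsion_free T -> pure_hulls_iso G T ->
  direct_sum2 [set: G] A (hom_radical T) -> clipped (@hom_radical G T).
Proof.
move=> tfG tfT hG [sA sR GAR AR] [B [C [[sB sC RBC BC] rB]]].
have [b Bb b0] := rank1_neq0 rB.
have [phi [injphi rphi]] := hG b b0.
have B_R y : B y -> hom_radical T y.
  move=> By; rewrite RBC; exists y => //.
  by exists 0; [exact: subgroup0 | rewrite addr0].
have C_R y : C y -> hom_radical T y.
  move=> Cy; rewrite RBC; exists 0; first exact: subgroup0.
  by exists y; rewrite ?add0r.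
have AR0 y : A y -> hom_radical T y -> y = 0.
  by move=> Ay Ry; suff : [set 0] y by []; rewrite -AR.
have BC0 y : B y -> C y -> y = 0.
  by move=> By Cy; suff : [set 0] y by []; rewrite -BC.
(* A direct summand of a pure subgroup is pure. *)
have pB : pure_subgroup B.
  apply/torsion_free_pureP => //; split=> // m y m0 Bym.
  have : hom_radical T y.
    have /torsion_free_pureP[//|_ pR] := hom_radical_pure tfG tfT.
    by apply: (pR m) => //; apply: B_R.
  rewrite {1}RBC => -[b' Bb' [c Cc yE]].
  suff c0 : c = 0 by rewrite -yE c0 addr0.
  apply: (torsion_freeMz tfG m0); apply: BC0; last exact: subgroupMz.
  have -> : c *~ m = y *~ m - b' *~ m by rewrite -yE mulrzDl addrC addKr.
  by apply: subgroupB => //; apply: subgroupMz.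
have hullE : pure_hull b = B.
  apply/seteqP; split; first by apply: smallest_sub => // _ ->.
  move=> y By; have [m [n [m0 ymn]]] := rank1_dependent tfG rB By Bb b0.
  have /torsion_free_pureP[//|sh ph] := pure_hull_pure b tfG.
  apply: (ph m) => //; rewrite ymn; apply: (subgroupMz n sh).
  by move=> P [_ bP]; apply: bP.
have Bphi t : B (phi t) by rewrite -hullE -rphi; exists t.
(* The graph of the projection of [G], the direct sum of [A], [C] and [B], onto [B], read in [T]
   through [phi]. *)
pose r x t := exists a c, [/\ A a, C c & x = a + c + phi t].
have rB2 x y t u : r x t -> r y u -> r (x - y) (t - u).
  move=> [a [c [Aa Cc ->]]] [a' [c' [Aa' Cc' ->]]].
  exists (a - a'), (c - c'); split; try exact: subgroupB.
  by rewrite (raddfB phi) !opprD addrACA [in LHS](addrACA a).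
have r0 t : r 0 t -> t = 0.
  move=> [a [c [Aa Cc e]]].
  have a0 : a = 0.
    apply: AR0 => //; have -> : a = - (c + phi t).
      by apply/eqP; rewrite -addr_eq0 addrA -e.
    exact: (subgroupN sR (subgroupD sR (C_R _ Cc) (B_R _ (Bphi t)))).
  apply: injphi; rewrite raddf0; apply: BC0 => //.
  have -> : phi t = - c.
    by apply/eqP; rewrite -addr_eq0 addrC e a0 add0r.
  exact: subgroupN.
have /choice[g gP] x : exists t, r x t.
  have : [set: G] x by [].
  rewrite GAR => -[a Aa [h + <-]]; rewrite RBC => -[y By [c Cc <-]].
  move: By; rewrite -hullE -rphi => -[t _ <-].
  by exists t, a, c; split=> //; rewrite -addrA [c + _]addrC.
have rI x t u : r x t -> r x u -> t = u.
  move=> xt xu; apply/eqP; rewrite -subr_eq0; apply/eqP; apply: r0.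
  by rewrite -(subrr x); apply: rB2.
have [f fE] : exists f : {additive G -> T}, f =1 g.
  apply: additive_of => x y; apply: (rI (x - y)); first exact: gP.
  by apply: rB2; apply: gP.
(* As [b] is in the radical, its component in [B] vanishes, although [b] is itself a non-zero
   element of [B]. *)
have fb : f b = 0 by apply: B_R Bb f.
have := gP b; rewrite -fE fb => -[a [c [Aa Cc]]]; rewrite raddf0 addr0 => e.
have a0 : a = 0.
  apply: AR0 => //; have -> : a = b - c by rewrite e addrK.
  exact: (subgroupB sR (B_R _ Bb) (C_R _ Cc)).
by apply: b0; apply: BC0 => //; rewrite e a0 add0r.
Qed.

(** * Ascending chains in which each term is a direct summand of the next *)

Fixpoint partial_sum (G : zmodType) (B : nat -> set G) (J : set nat) n :
    set G :=
  if n is m.+1 then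
    if `[< J m >] then [set a + b | a in partial_sum B J m & b in B m]
    else partial_sum B J m
  else [set 0].

Section Chain.
Variables (G : zmodType) (K B : nat -> set G).
Hypothesis KB : forall n, direct_sum2 (K n.+1) (K n) (B n).

Let sK n : subgroup (K n). Proof. by case: (KB n). Qed.

Let sB n : subgroup (B n). Proof. by case: (KB n). Qed.

Lemma chain_sub n : K n `<=` K n.+1.
Proof.
move=> x Kx; have [_ _ -> _] := KB n.
by exists x => //; exists 0; [exact: subgroup0 | rewrite addr0].
Qed.

Lemma chain_summand n : B n `<=` K n.+1.
Proof.
move=> x Bx; have [_ _ -> _] := KB n.
by exists 0; [exact: subgroup0 | exists x; rewrite ?add0r].
Qed.

Lemma chain_mono m n : (m <= n)%N -> K m `<=` K n.
Proof.
by move=> /subnK <-; elim: (n - m)%N => // k IHk x /IHk; apply: chain_sub.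
Qed.

Lemma partial_sum_chain J n : partial_sum B J n `<=` K n.
Proof.
elim: n => [_ ->|n IHn x /=]; first exact: subgroup0.
case: asboolP => _; last by move=> /IHn; apply: chain_sub.
move=> [a /IHn Ka [b Bb <-]].
by apply: subgroupD => //; [exact: chain_sub | exact: chain_summand].
Qed.

Lemma partial_sum_subgroup J n : subgroup (partial_sum B J n).
Proof.
elim: n => [|n IHn] /=.
  by apply/subgroupP; split=> // x y -> ->; exact: subr0.
case: asboolP => _ //; apply/subgroupP; split.
  exists 0; first exact: subgroup0.
  by exists 0; [exact: subgroup0 | rewrite addr0].
move=> _ _ [a Sa [b Bb <-]] [a' Sa' [b' Bb' <-]].
exists (a - a'); first exact: subgroupB.
by exists (b - b'); [exact: subgroupB | rewrite opprD addrACA].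
Qed.

Lemma partial_sum_mono J m n : (m <= n)%N ->
  partial_sum B J m `<=` partial_sum B J n.
Proof.
move=> /subnK <-; elim: (n - m)%N => // k IHk x /IHk /=.
case: asboolP => // _ Sx; exists x => //.
by exists 0; [exact: subgroup0 | rewrite addr0].
Qed.

(** The partial sums increase, so their union is a subgroup; elements of the generated subgroup thus
    appear at a finite stage, where induction is possible. *)
Lemma generated_partial_sum J :
  generated (\bigcup_(j in J) B j) `<=` \bigcup_n partial_sum B J n.
Proof.
apply: smallest_sub.
  apply/subgroupP; split; first by exists 0%N.
  move=> x y [m _ Sx] [n _ Sy]; exists (maxn m n) => //.
  apply: subgroupB; first exact: partial_sum_subgroup.
    exact: partial_sum_mono (leq_maxl m n) _ Sx.
  exact: partial_sum_mono (leq_maxr m n) _ Sy.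
move=> x [j Jj Bx]; exists j.+1 => //=; case: asboolP => // _.
exists 0; first exact: (subgroup0 (partial_sum_subgroup J j)).
by exists x; rewrite ?add0r.
Qed.

(** Top components are stripped one at a time: when [m <= n], the component of [x] in [B n] is a
    difference of elements of [K n], hence zero. *)
Lemma generated_chainI J m x :
  generated (\bigcup_(j in J) B j) x -> K m x -> partial_sum B J m x.
Proof.
move=> /generated_partial_sum[n _]; elim: n => [|n IHn] Sx Kx.
  exact: partial_sum_mono (leq0n m) _ Sx.
have [le_nm|lt_mn] := leqP n.+1 m; first exact: partial_sum_mono le_nm _ Sx.
apply: IHn => //; move: Sx => /=; case: asboolP => // _ [a Sa [b Bb abx]].
suff b0 : b = 0 by rewrite -abx b0 addr0.
have [_ _ _ KB0] := KB n; suff : [set 0] b by []; rewrite -KB0; split=> //.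
have -> : b = x - a by rewrite -abx addrC addKr.
by apply: subgroupB => //; [exact: chain_mono Kx | exact: partial_sum_chain Sa].
Qed.

Lemma generated_chain_disjoint J :
  generated (\bigcup_(j in J) B j) `&` K 0 = [set 0].
Proof.
apply/seteqP; split=> [x [gx Kx]|x ->]; first exact: generated_chainI gx Kx.
by split=> [P [sP _]|]; exact: subgroup0.
Qed.

(** Stripping brings the element down to stage [i.+1]; as [i] is not in [J], that stage adds nothing
    to stage [i], which lies in [K i]. *)
Lemma generated_chain_independent J i : ~ J i ->
  B i `&` generated (\bigcup_(j in J) B j) = [set 0].
Proof.
move=> Ji; apply/seteqP; split=> [x [Bx gx]|x ->]; last first.
  by split=> [|P [sP _]]; exact: subgroup0.
have [_ _ _ <-] := KB i; split=> //; apply: (@partial_sum_chain J).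
have := generated_chainI gx (chain_summand Bx).
by rewrite /=; case: asboolP.
Qed.

End Chain.

(** * Iterating the extension along an enumeration of [G] *)

Theorem theorem2p15 (tau : zmodType -> Prop) (G : zmodType)
    (htau : is_type tau) (tfG : torsion_free G)
    (cG : countable [set: G]) (hG : homogeneous tau G) :
  exists A H : set G, main_decomposition A H.
Proof.
have [T [tfT rT tauE]] := htau.
have hullG : pure_hulls_iso G T.
  move=> x x0; have : type_of x T.
    rewrite (hG x x0) tauE; exists idfun => //.
    by apply/seteqP; split=> // y _; exists y.
  by case=> phi; exists phi.
(* The chain starts at the radical, where the zero map serves as a projection modulo the radical. *)
have qR : quasi_summand T (@hom_radical G T).
  split=> //; first exact: hom_radical_pure.
  exists \0, 1; split=> // [g|k Rk] /=.
    by have [sR _] := hom_radical_pure tfG tfT; apply: subgroup0.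
  by move=> f; rewrite sub0r mulr1z raddfN Rk oppr0.
have [f injf] := countable_injP _ cG.
have [e eK] : exists e : nat -> G, forall x, exists n, e n = x.
  exists (fun n => xget 0 [set x | f x = n]) => x; exists (f x).
  case: xgetP => [y _ /= fyx|/(_ x) []//].
  by apply: injf; rewrite ?in_setE.
(* Each subgroup carries its proof of being a quasi-summand, so that choice yields a total step
   function. *)
pose Q := {K : set G | quasi_summand T K}.
have /choice[F FP] (p : Q * G) : exists r : Q * set G,
    [/\ direct_sum2 (sval r.1) (sval p.1) r.2, sval r.1 p.2
      & r.2 = [set 0] \/
        exists s : {additive T -> G}, injective s /\ range s = r.2].
  case: p => [[K qK] x].
  have [K' [B [qK' KB K'x hB]]] :=
    quasi_summand_extend x tfG tfT rT hullG qK.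
  by exists (exist _ K' qK', B).
pose chain := fix chain n : Q :=
  if n is m.+1 then (F (chain m, e m)).1 else exist _ _ qR.
pose K n := sval (chain n).
pose B n := (F (chain n, e n)).2.
have KB n : direct_sum2 (K n.+1) (K n) (B n) by have [] := FP (chain n, e n).
have Ke n : K n.+1 (e n) by have [] := FP (chain n, e n).
(* Stages at which [e n] was already absorbed contribute zero, which has not rank one, and are
   dropped. The boolean predicate makes [val] injective. *)
pose I := {n : nat | `[< B n <> [set 0] >]}.
have sI (J : set I) :
    \bigcup_(i in J) B (val i) `<=` \bigcup_(j in val @` J) B j.
  by move=> x [i Ji Bx]; exists (val i) => //; exists i.
pose A := generated (\bigcup_(i : I) B (val i)).
have sB n : subgroup (B n) by have [] := KB n.
have sA : subgroup A by exact: subgroup_generated.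
exists A, (hom_radical T).
have dsG : direct_sum2 [set: G] A (hom_radical T).
  split=> //.
  - by have [] := hom_radical_pure tfG tfT.
  - apply/seteqP; split=> // x _; have [n <-] := eK x.
    suff KA m : K m `<=` [set a + b | a in A & b in hom_radical T].
      exact: KA (Ke n).
    elim: m => [y Ry|m IHm y].
      by exists 0; [exact: subgroup0 | exists y; rewrite ?add0r].
    have [_ _ -> _] := KB m; move=> [k /IHm[a Aa [h Rh <-]] [b Bb <-]].
    have [B0|B0] := pselect (B m = [set 0]).
      exists a => //; exists h => //.
      by move: Bb; rewrite B0 => ->; rewrite addr0.
    exists (a + b); last by exists h => //; rewrite addrAC.
    apply: (subgroupD sA Aa) => P [_ BP]; apply: BP.
    by exists (exist _ m (asboolT B0)).
  - apply/seteqP; split=> [x [Ax Rx]|x ->]; last first.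
      by split; apply: subgroup0 => //; have [] := hom_radical_pure tfG tfT.
    (* Here [K 0] is the radical. *)
    rewrite -(generated_chain_disjoint KB (val @` [set: I])).
    by split=> //; apply: generated_mono Ax; apply: sI.
split=> //; last exact: hom_radical_clipped dsG.
exists I, (fun i => B (val i)); split; last first.
  move=> [n /= /asboolP B0]; have [_ _ [//|[s [injs sE]]]] := FP (chain n, e n).
  rewrite /B -sE; exact: has_rank1_range.
split=> // i; apply/seteqP; split=> [x [Bx gx]|x ->]; last first.
  by split=> [|P [sP _]]; exact: subgroup0.
rewrite -(generated_chain_independent KB (i := val i)
            (J := val @` [set j | j <> i])).
  by split=> //; apply: generated_mono gx; apply: sI.
by move=> [j ji /val_inj].
Qed.
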